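(* Let $A$ and $B$ be two nontrivial linear subspaces of $\mathbb R^d$ (each $\neq\{0\}$ and $\neq\mathbb R^d$), with Friedrichs angle $\theta_F=\theta_F(A,B)$. Let $a_0=x_0\in\mathbb R^d$ and, for $k=1,2,\ldots$, put $a_k:=(P_AP_B)^k(a_0)$ and $x_k:=\left(\frac{P_A+P_B}{2}\right)^k(x_0)$. Assume that $\|a_1-P_{A\cap B}(a_0)\|>0$. Then, for each $k=1,2,\ldots$, $$\|a_k-P_{A\cap B}(a_0)\|>0\quad\text{and}\quad\|x_k-P_{A\cap B}(x_0)\|>0.$$ Moreover, for each $k=0,1,2,\ldots$, $$\|a_{k+1}-P_{A\cap B}(a_0)\|\leq c_k\,\|a_k-P_{A\cap B}(a_0)\|,\qquad c_0:=\sqrt\lambda,\quad c_k:=\lambda\ \text{ for }k\geq1,$$ and $$\|x_{k+1}-P_{A\cap B}(x_0)\|\leq\mu\,\|x_k-P_{A\cap B}(x_0)\|,$$ where the rates of $Q$-linear convergence satisfy $$\lambda:=\lim_{k\to\infty}\frac{\|a_{k+1}-P_{A\cap B}(a_0)\|}{\|a_k-P_{A\cap B}(a_0)\|}=\max\Big\{\Lambda(a_0,P_BP_AP_B)\setminus\{0,1\}\Big\}$$ and $$\mu:=\lim_{k\to\infty}\frac{\|x_{k+1}-P_{A\cap B}(x_0)\|}{\|x_k-P_{A\cap B}(x_0)\|}=\max\Big\{\Lambda\big(x_0,\tfrac{P_A+P_B}{2}\big)\setminus\{0,1\}\Big\}$$ (in particular, both limits exist and both sets on the right are nonempty). In particular,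 $\lambda\in(0,\cos^2(\theta_F)]$ and $\mu\in[\frac12-\frac12\cos(\theta_F),\frac12+\frac12\cos(\theta_F)]$.
   Context: $\mathbb R^d$ is equipped with an arbitrary inner product $\langle\cdot,\cdot\rangle$ and the induced norm $\|\cdot\|$. For a subspace $M\subset\mathbb R^d$, $P_M$ denotes the orthogonal projection onto $M$. The Friedrichs angle $\theta_F=\theta_F(A,B)\in[0,\frac\pi2]$ is defined by $\cos(\theta_F)=\max\{\langle a,b\rangle: a\in A\cap(A\cap B)^\perp,\ b\in B\cap(A\cap B)^\perp,\ \|a\|\le1,\ \|b\|\leq1\}$. For a linear operator $T$ on $\mathbb R^d$, $\mathcal N(T)$ is its null space, $\lambda-T$ stands for $\lambda I-T$, $\Lambda(T):=\{\lambda\in\mathbb R:\mathcal N(\lambda-T)\neq\{0\}\}$ is the set of eigenvalues, and for $x\in\mathbb R^d$, $\Lambda(x,T):=\{\lambda\in\Lambda(T):P_{\mathcal N(\lambda-T)}(x)\neq0\}$. *)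

(* Defs.v *)
From HB Require Import structures.
From mathcomp Require Import all_boot all_order all_algebra.
From mathcomp Require Import all_classical all_reals all_analysis.
Set Implicit Arguments.
Unset Strict Implicit.
Unset Printing Implicit Defensive.
Import Order.TTheory GRing.Theory Num.Theory.
Import numFieldNormedType.Exports.
Local Open Scope classical_set_scope.
Local Open Scope ring_scope.

(* An inner product on V is a [dot : {dot V for idfun}]: a symmetric bilinear
   form with [0 < dot u u] for [u != 0]; no particular one is singled out. *)
Section InnerProduct.
Variables (R : realType) (V : vectType R) (dot : {dot V for idfun}).

Definition dot_norm (u : V) : R := Num.sqrt (dot u u).

(* [daddv_pi M N] is the linear projection onto M along N. *)
Definition orth_proj (M : {vspace V}) : 'End(V) := daddv_pi M (orthov dot M).

Definition is_max (S : set R) (m : R) : Prop := S m /\ ubound S m.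

Definition is_friedrichs_angle (A B : {vspace V}) (theta : R) : Prop :=
  0 <= theta <= pi / 2 /\
  is_max [set r | exists a b : V,
            [/\ a \in (A :&: orthov dot (A :&: B))%VS,
                b \in (B :&: orthov dot (A :&: B))%VS,
                dot_norm a <= 1, dot_norm b <= 1 & r = dot a b]]
         (cos theta).

(* [passmx.leigenspace T l] is the null space of [T - l *: \1]. *)
Definition eigenvalues (T : 'End(V)) : set R := [set l | passmx.leigenvalue T l].

Definition eigenvalues_at (x : V) (T : 'End(V)) : set R :=
  [set l | eigenvalues T l /\ orth_proj (passmx.leigenspace T l) x != 0].

End InnerProduct.

(* Main.v *)
Require Import Defs.
From HB Require Import structures.
From mathcomp Require Import all_boot all_order all_algebra.
From mathcomp Require Import all_classical all_reals all_analysis.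
From mathcomp Require Import complex ring lra.
Set Implicit Arguments.
Unset Strict Implicit.
Unset Printing Implicit Defensive.
Import Order.TTheory GRing.Theory Num.Theory.
Import numFieldNormedType.Exports.
Local Open Scope classical_set_scope.
Local Open Scope ring_scope.

(** Both iterations are governed by a self-adjoint positive operator [T] that
    fixes exactly the vectors of [A :&: B]: [T = P_B P_A P_B] for alternating
    projections, thanks to [(P_A P_B)^(k+1) = P_A P_B (P_B P_A P_B)^k], and
    [T = (P_A + P_B) / 2] for averaged projections. Let
    [z = x - P_(A :&: B) x]. Then the squared errors are moments
    [m_j = <z, T^j z>]: of order [2k - 1] for [k >= 1] (and [0] for [k = 0]) in
    the first case ([alternating_error]), of order [2k] in the second
    ([average_error]).

    By the spectral theorem ([spectral_decomposition]), [z] is the sum of its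
    projections [z_r] on the eigenspaces of [T], whence
    [m_j = \sum_r r ^+ j * |z_r|^2]. If [lam] is the largest [r] with
    [z_r != 0], then [m_(j+1) <= lam * m_j] and [m_(j+1) / m_j] tends to [lam]
    ([spectral_rate]). Since [z] and [x] have the same components outside the
    eigenspace of [1], where [z] has none, [lam] is the largest eigenvalue in
    the support of [x] other than [0] and [1]. One step of either iteration is
    two steps in [j], so the quotients of the errors tend to [lam]; only the
    first alternating step goes from [m_0] to [m_1], with [sqrt lam] as its
    factor.

    The real spectral theorem is obtained from the existence of an eigenvector
    in every nonzero stable subspace: a nonzero vector is annihilated by some
    real polynomial in [T], this polynomial has factors of degree at most two,
    and a factor without real roots acts injectively because [T] is
    self-adjoint ([poly_act_eigenvector]).

    For the bounds by the Friedrichs angle, an eigenvector for an eigenvalue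
    other than [1] is orthogonal to [A :&: B], and so are its projections on
    [A] and [B]; the inner product of the two relevant projections is on the one
    hand a function of the eigenvalue, on the other hand at most [cos theta]
    times the product of their norms ([sandwich_eigenvalue_le],
    [average_eigenvalue_bounds]). *)

(** * Inner products and orthogonal projections *)

Section InnerProductTheory.
Variables (R : realType) (V : vectType R) (dot : {dot V for idfun}).
Implicit Types (u v w x : V) (M N : {vspace V}) (T : 'End(V)).

Lemma dotC u v : dot u v = dot v u.
Proof. by rewrite hermC expr0 mul1r. Qed.

Lemma dot0l u : dot 0 u = 0. Proof. exact: linear0l. Qed.
Lemma dot0r u : dot u 0 = 0. Proof. exact: linear0r. Qed.
Lemma dotDl u v w : dot (u + v) w = dot u w + dot v w.
Proof. exact: linearDl. Qed.
Lemma dotBl u v w : dot (u - v) w = dot u w - dot v w.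
Proof. exact: linearBl. Qed.
Lemma dotBr u v w : dot u (v - w) = dot u v - dot u w.
Proof. exact: linearBr. Qed.
Lemma dotZl a u v : dot (a *: u) v = a * dot u v.
Proof. exact: linearZl_LR. Qed.
Lemma dotZr a u v : dot u (a *: v) = a * dot u v.
Proof. exact: linearZr_LR. Qed.

Lemma dot_ge0 u : 0 <= dot u u.
Proof.
have [->|u0] := eqVneq u 0; first by rewrite dot0r.
exact/ltW/neq0_dnorm_gt0.
Qed.

Lemma dot_eq0 u : (dot u u == 0) = (u == 0).
Proof.
have [->|u0] := eqVneq u 0; first by rewrite dot0r eqxx.
by apply/negbTE; rewrite gt_eqF ?neq0_dnorm_gt0.
Qed.

Lemma dot_gt0 u : (0 < dot u u) = (u != 0).
Proof. by rewrite lt_def dot_eq0 dot_ge0 andbT. Qed.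

Lemma sqr_dot_norm u : dot_norm dot u ^+ 2 = dot u u.
Proof. by rewrite sqr_sqrtr ?dot_ge0. Qed.

Lemma dot_norm_gt0 u : (0 < dot_norm dot u) = (u != 0).
Proof. by rewrite sqrtr_gt0 dot_gt0. Qed.

(** The form seen as a plain inner product rather than through its Hermitian
    structure, so that the rewriting lemmas above apply to the result. *)
Lemma orthov_dotP M u :
  reflect (forall v, v \in M -> dot u v = 0) (u \in orthov dot M).
Proof. exact: (mem_orthovP (form := dot)). Qed.

Lemma capv_orthov M : (M :&: orthov dot M)%VS = 0%VS.
Proof.
apply/eqP; rewrite -subv0; apply/subvP=> u /memv_capP[uM /orthov_dotP uo].
by rewrite memv0 -dot_eq0 uo.
Qed.

(** Each further vector costs at most one dimension of the orthogonal
    complement. This is the half of the dimension count that makes a subspace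
    and its orthogonal span everything. *)
Lemma dim_orthov_span (X : seq V) :
  (\dim {:V} <= \dim (orthov dot <<X>>%VS) + size X)%N.
Proof.
elim: X => [|u X IHX]; first by rewrite span_nil orthov0 addn0.
rewrite span_cons (leq_trans IHX)//= addnS -addSn leq_add2r.
have : (orthov dot <<X>>%VS :&: orthov dot <[u]> <=
        orthov dot (<[u]> + <<X>>%VS))%VS.
  by rewrite orthovD capvSr capvSl.
move=> /dimvS; have := leq_dim_orthov1 dot u (orthov dot <<X>>%VS).
by move=> /leq_trans h /h; rewrite -ltnS; case: (\dim (orthov dot <<X>>%VS)).
Qed.

Lemma addv_orthov M : (M + orthov dot M)%VS = fullv.
Proof.
apply/eqP; rewrite eqEdim subvf/= dimv_disjoint_sum ?capv_orthov//.
have := dim_orthov_span (vbasis M).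
by rewrite (span_basis (vbasisP M)) size_tuple addnC.
Qed.

Lemma orth_proj_in M w : orth_proj dot M w \in M.
Proof. exact: memv_pi. Qed.

Lemma orth_proj_perp M w : w - orth_proj dot M w \in orthov dot M.
Proof.
rewrite -{1}(@daddv_pi_add _ _ M (orthov dot M) w) ?capv_orthov//; last first.
  by rewrite addv_orthov memvf.
by rewrite addrC addKr memv_pi.
Qed.

(** The form in which the defining property of the orthogonal projection is
    used: against vectors of [M], a vector and its projection are the same. *)
Lemma orth_proj_dotl M u v : v \in M -> dot (orth_proj dot M u) v = dot u v.
Proof.
move=> vM; have /orthov_dotP/(_ _ vM) := orth_proj_perp M u.
by rewrite dotBl => /eqP; rewrite subr_eq0 => /eqP ->.
Qed.

Lemma orth_proj_id M u : u \in M -> orth_proj dot M u = u.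
Proof. by move=> uM; rewrite /orth_proj daddv_pi_id ?capv_orthov. Qed.

Lemma orth_proj_eq0 M u : (orth_proj dot M u == 0) = (u \in orthov dot M).
Proof.
apply/eqP/orthov_dotP => [Pu0 v vM|uM].
  by rewrite -(orth_proj_dotl u vM) Pu0 dot0l.
by apply/eqP; rewrite -dot_eq0 orth_proj_dotl ?orth_proj_in// uM// orth_proj_in.
Qed.

Definition self_adjoint T := forall u v, dot (T u) v = dot u (T v).

Lemma orth_proj_self_adjoint M : self_adjoint (orth_proj dot M).
Proof.
move=> u v; rewrite -(orth_proj_dotl u (orth_proj_in _ _)).
by rewrite dotC -(orth_proj_dotl v (orth_proj_in _ _)) dotC.
Qed.

Lemma dot_orth_proj M u :
  dot (orth_proj dot M u) u = dot (orth_proj dot M u) (orth_proj dot M u).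
Proof. by rewrite [RHS]orth_proj_dotl ?orth_proj_in// dotC. Qed.

Lemma mem_leigenspace T l u : (u \in passmx.leigenspace T l) = (T u == l *: u).
Proof. by rewrite memv_ker !lfun_simp/= subr_eq0. Qed.

Lemma leigenvalue_witness T l u :
  T u = l *: u -> u != 0 -> passmx.leigenvalue T l.
Proof.
move=> Tu; apply: contra_neq => E0; apply/eqP.
by rewrite -memv0 -E0 mem_leigenspace Tu.
Qed.

Lemma eigenspaces_orthogonal T l m u v : self_adjoint T -> l != m ->
  T u = l *: u -> T v = m *: v -> dot u v = 0.
Proof.
move=> Tsa lm Tu Tv; have := Tsa u v.
rewrite Tu Tv dotZl dotZr => /eqP; rewrite -subr_eq0 -mulrBl.
by rewrite mulf_eq0 subr_eq0 (negbTE lm) => /eqP.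
Qed.

End InnerProductTheory.

(** * Eigenvectors of self-adjoint operators *)

(** A complex root [a + ib] of [p] gives the first kind of factor when [b = 0];
    otherwise its conjugate is a root too, and the two linear factors multiply
    to the real quadratic [(X - a)^2 + b^2]. *)
Lemma real_poly_factor (R : rcfType) (p : {poly R}) : (1 < size p)%N ->
  exists2 f : {poly R}, f %| p &
    (exists r, f = 'X - r%:P) \/
    (exists a b, b != 0 /\ f = ('X - a%:P) ^+ 2 + (b ^+ 2)%:P).
Proof.
move=> p_gt1; pose toC : {rmorphism R -> R[i]} := real_complex R.
have /closed_rootP[z pz] : size (map_poly toC p) != 1%N.
  by rewrite size_map_poly gtn_eqF.
have pzc : root (map_poly toC p) (conjc z).
  rewrite -complex_root_conj -map_poly_comp; congr (root _ _): pz.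
  by apply: eq_map_poly => x; rewrite /toC /= oppr0.
case: z pz pzc => a b pz pzc; have [b0|b0] := eqVneq b 0.
  exists ('X - a%:P); last by left; exists a.
  rewrite dvdp_XsubCl -(fmorph_root toC).
  by move: pz; rewrite b0.
exists (('X - a%:P) ^+ 2 + (b ^+ 2)%:P); last by right; exists a, b.
rewrite -(dvdp_map toC).
have -> : map_poly toC (('X - a%:P) ^+ 2 + (b ^+ 2)%:P) =
    \prod_(z <- [:: (a +i* b)%C; (a -i* b)%C]) ('X - z%:P).
  rewrite !(rmorphD, rmorphN, rmorphXn)/= !map_polyX !map_polyC/=.
  rewrite big_cons big_seq1.
  have -> : (a +i* b)%C = toC a + toC b * 'i%C by rewrite /toC; simpc.
  have -> : (a -i* b)%C = toC a - toC b * 'i%C by rewrite /toC; simpc.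
  have i2 : ('i%C : R[i])%:P ^+ 2 = - 1 :> {poly R[i]}.
    by rewrite -polyC_exp sqr_i polyCN.
  rewrite polyCD polyCB polyCM /toC/=.
  set A := (_ a)%:P; set B := (_ b)%:P; set I := 'i%C%:P in i2 *.
  transitivity (('X - A) ^+ 2 - B ^+ 2 * I ^+ 2); first by rewrite i2; ring.
  by ring.
apply: uniq_roots_dvdp; first by rewrite /= pz pzc.
rewrite uniq_rootsE/= inE andbT eq_complex/= eqxx/=.
by rewrite -subr_eq0 opprK -mulr2n mulrn_eq0.
Qed.

Section EigenvectorExistence.
Variables (R : realType) (V : vectType R) (T : 'End(V)).
Implicit Types (p q : {poly R}) (u v : V) (U : {vspace V}).

(** [p(T) v]; summing over powers of [T], rather than evaluating [p] in an
    algebra of endomorphisms, also covers the zero space. *)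
Definition poly_act p v : V := \sum_(i < size p) p`_i *: iter i T v.

Lemma poly_act_widen p v n : (size p <= n)%N ->
  poly_act p v = \sum_(i < n) p`_i *: iter i T v.
Proof.
move=> pn; rewrite /poly_act (big_ord_widen n (fun i => p`_i *: iter i T v))//.
rewrite big_mkcond; apply: eq_bigr => i _; case: ltnP => // /(nth_default 0) ->.
by rewrite scale0r.
Qed.

Lemma poly_actD p q v : poly_act (p + q) v = poly_act p v + poly_act q v.
Proof.
pose n := maxn (size p) (size q).
rewrite (@poly_act_widen _ _ n) ?size_polyD//.
rewrite (@poly_act_widen p _ n) ?leq_maxl// (@poly_act_widen q _ n) ?leq_maxr//.
by rewrite -big_split; apply: eq_bigr => i _; rewrite coefD scalerDl.
Qed.

Lemma poly_actC c v : poly_act c%:P v = c *: v.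
Proof.
by rewrite (@poly_act_widen _ _ 1) ?size_polyC_leq1// big_ord1 coefC.
Qed.

Lemma poly_actMX p v : poly_act (p * 'X) v = T (poly_act p v).
Proof.
rewrite (@poly_act_widen _ _ (size p).+1); last first.
  by rewrite (leq_trans (size_polyMleq _ _))// size_polyX addn2.
rewrite big_ord_recl coefMX scale0r add0r linear_sum/=.
by apply: eq_bigr => i _; rewrite coefMX/= linearZ.
Qed.

Lemma poly_actZ c p v : poly_act (c *: p) v = c *: poly_act p v.
Proof.
rewrite (@poly_act_widen _ _ (size p)) ?size_scale_leq// scaler_sumr.
by apply: eq_bigr => i _; rewrite coefZ scalerA.
Qed.

Lemma poly_actM p q v : poly_act (p * q) v = poly_act p (poly_act q v).
Proof.
elim/poly_ind: p => [|p c IHp].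
  by rewrite mul0r !poly_actC !scale0r.
rewrite mulrDl -mulrA ['X * q]mulrC mulrA !poly_actD !poly_actMX IHp.
by rewrite mul_polyC poly_actZ poly_actC.
Qed.

Lemma poly_act_stable U p v : (T @: U <= U)%VS -> v \in U -> poly_act p v \in U.
Proof.
move=> TU vU; apply: rpred_sum => i _; apply: rpredZ.
by elim: (i : nat) => //= k IHk; apply: (subvP TU); rewrite memv_img.
Qed.

(** The vectors [v], [T v], ..., [T^n v], with [n] the dimension of the space,
    are linearly dependent. *)
Lemma poly_act_annihilator v : exists2 p, p != 0 & poly_act p v = 0.
Proof.
apply: contrapT => noP; pose n := \dim {:V}.
pose X : n.+1.-tuple V := [tuple iter i T v | i < n.+1].
suff /eqnP XE : free X.
  by have := dimvS (subvf <<X>>%VS); rewrite XE size_tuple ltnn.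
apply/freeP => k kX i; pose p := \poly_(j < n.+1) k (inord j).
have pv : poly_act p v = 0.
  rewrite (@poly_act_widen _ _ n.+1) ?size_poly// -[RHS]kX.
  apply: eq_bigr => j _.
  by rewrite coef_poly ltn_ord inord_val -tnth_nth tnth_mktuple.
have p0 : p = 0 by apply: contrapT => /eqP p0; apply: noP; exists p.
by move: (coef0 R i); rewrite -p0 coef_poly ltn_ord inord_val.
Qed.

Variables (dot : {dot V for idfun}) (Tsa : self_adjoint dot T).

(** Peel a real factor [f] off the annihilating polynomial, [p = q f]. Either
    [q] already annihilates [v], and the degree has dropped, or [u = q(T) v] is
    a nonzero vector killed by [f(T)]. If [f = X - r], then [u] is an
    eigenvector. The quadratic case is where self-adjointness enters: pairing
    [((T - a)^2 + b^2) u = 0] with [u] gives [|(T - a) u|^2 + b^2 |u|^2 = 0],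
    which is absurd for [b != 0]. *)
Lemma poly_act_eigenvector p v :
  p != 0 -> v != 0 -> poly_act p v = 0 ->
  exists q r, poly_act q v != 0 /\ T (poly_act q v) = r *: poly_act q v.
Proof.
have [m] := ubnP (size p); elim: m p => // m IHm p; rewrite ltnS => pm p0 v0 pv.
have [p1|p1] := leqP (size p) 1.
  move: p0 pv; rewrite (size1_polyC p1) polyC_eq0 poly_actC => c0.
  by move=> /eqP; rewrite scaler_eq0 (negbTE c0) (negbTE v0).
have [f /dvdpP[q pE] fE] := real_poly_factor p1.
have q0 : q != 0 by apply: contra_neq p0 => q0; rewrite pE q0 mul0r.
have [qv|qv] := eqVneq (poly_act q v) 0.
  apply: IHm qv => //; apply: leq_trans pm; rewrite pE.
  have f1 : (1 < size f)%N.
    case: fE => [[r ->]|[a [b [b0 ->]]]]; first by rewrite size_XsubC.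
    by rewrite size_polyDl size_exp_XsubC// size_polyC expf_neq0.
  have f0 : f != 0 by rewrite -size_poly_gt0 (ltn_trans _ f1).
  rewrite size_mul//; case: (size f) f1 => // k k0.
  by rewrite addnS/= -[X in (X < _)%N]addn0 ltn_add2l.
have act_XsubC a u : poly_act ('X - a%:P) u = T u - a *: u.
  by rewrite -['X]mul1r -polyCN poly_actD poly_actMX !poly_actC scale1r scaleNr.
exists q; move: pv; rewrite pE mulrC poly_actM; set u := poly_act q v in qv *.
case: fE => [[r ->]|[a [b [b0 ->]]]].
  by rewrite act_XsubC => /eqP; rewrite subr_eq0 => /eqP ?; exists r.
rewrite poly_actD expr2 poly_actM !act_XsubC poly_actC.
set w := T u - a *: u => /(congr1 (dot^~ u)) /=.
have wE : dot (T w - a *: w) u = dot w w.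
  by rewrite dotBl dotZl Tsa {3}/w dotBr dotZr.
rewrite dotDl dotZl wE dot0l => /eqP.
rewrite paddr_eq0 ?dot_ge0//; last by rewrite (mulr_ge0 (sqr_ge0 b))// dot_ge0.
move=> /andP[_].
by rewrite mulf_eq0 sqrf_eq0 (negbTE b0) dot_eq0 (negbTE qv).
Qed.

(** Being of the form [q(T) v], the eigenvector stays in any stable subspace
    that contains [v]. *)
Lemma self_adjoint_stable_eigenvector U : (T @: U <= U)%VS -> U != 0%VS ->
  exists u r, [/\ u \in U, u != 0 & T u = r *: u].
Proof.
move=> TU U0; have vU := memv_pick U; have v0 : vpick U != 0 by rewrite vpick0.
have [p p0 pv] := poly_act_annihilator (vpick U).
have [q [r [qv0 qvr]]] := poly_act_eigenvector p0 v0 pv.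
by exists (poly_act q (vpick U)), r; rewrite poly_act_stable.
Qed.

End EigenvectorExistence.

(** * Spectral decomposition *)

Section SpectralTheorem.
Variables (R : realType) (V : vectType R) (dot : {dot V for idfun}).
Variables (T : 'End(V)) (Tsa : self_adjoint dot T).
Implicit Types (rs : seq R) (x y z : V).

Local Notation E l := (passmx.leigenspace T l).
Local Notation P l := (orth_proj dot (E l)).

Lemma eigen_proj l x : T (P l x) = l *: P l x.
Proof. by apply/eqP; rewrite -mem_leigenspace orth_proj_in. Qed.

Lemma eigen_proj_orthogonal l m x y : l != m -> dot (P l x) (P m y) = 0.
Proof. by move=> lm; rewrite (eigenspaces_orthogonal Tsa lm)// eigen_proj. Qed.

(** Add eigenvalues one at a time: the vectors orthogonal to the eigenspaces
    collected so far form a stable subspace [U], and as long as [U] is nonzero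
    it contains an eigenvector, hence a new eigenvalue, whose eigenspace cuts
    [U] down strictly. *)
Lemma eigenspaces_complete : exists rs, uniq rs /\
  forall y, (forall r, r \in rs -> y \in orthov dot (E r)) -> y = 0.
Proof.
suff: forall m (U : {vspace V}) rs, (\dim U < m)%N -> uniq rs ->
    (forall y, y \in U <-> forall r, r \in rs -> y \in orthov dot (E r)) ->
    exists rs, uniq rs /\
      forall y, (forall r, r \in rs -> y \in orthov dot (E r)) -> y = 0.
  by move/(_ _ fullv [::] (ltnSn _)); apply=> // y; split=> // _; exact: memvf.
elim=> // m IHm U rs; rewrite ltnS => Um rsU UP.
have [U0|U0] := eqVneq U 0%VS.
  by exists rs; split=> // y /UP; rewrite U0 memv0 => /eqP.
have TU : (T @: U <= U)%VS.
  apply/subvP=> _ /memv_imgP[y /UP yU ->]; apply/UP => r rrs.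
  apply/orthov_dotP => v vE; rewrite Tsa.
  move: (vE); rewrite mem_leigenspace => /eqP ->.
  by rewrite dotZr (orthov_dotP _ _ _ (yU r rrs))// mulr0.
(* The eigenvalue r is new because u lies both in U and in E r. *)
have [u [r [uU u0 Tu]]] := self_adjoint_stable_eigenvector Tsa TU U0.
have uE : u \in E r by rewrite mem_leigenspace Tu.
have uNo : u \notin orthov dot (E r).
  by apply/negP => /orthov_dotP/(_ u uE)/eqP; rewrite dot_eq0 (negbTE u0).
have UU' : (U :&: orthov dot (E r) <= U)%VS by exact: capvSl.
apply: (IHm (U :&: orthov dot (E r))%VS (r :: rs)).
- apply: leq_trans Um; rewrite ltn_neqAle dimvS// andbT.
  apply: contraNneq uNo => dimE; apply: (subvP (capvSr U _)).
  have /eqP -> // : (U :&: orthov dot (E r))%VS == U.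
  by rewrite eqEdim UU' dimE leqnn.
- rewrite /= rsU andbT; apply: contraNN uNo => rrs.
  exact: (UP u).1.
move=> y; split=> [/memv_capP[/UP yU yr] s|yU].
  by rewrite inE => /orP[/eqP ->//|]; exact: yU.
rewrite memv_cap yU ?mem_head// andbT; apply/UP => s srs.
by apply: yU; rewrite inE srs orbT.
Qed.

(** What is left of [x] after subtracting its components is orthogonal to every
    eigenspace of the list. *)
Lemma spectral_decomposition : exists rs, forall x, x = \sum_(r <- rs) P r x.
Proof.
have [rs [rsU rsP]] := eigenspaces_complete; exists rs => x.
apply/eqP; rewrite -subr_eq0; apply/eqP/rsP => r rrs.
rewrite -orth_proj_eq0 linearB linear_sum/= (bigD1_seq r)//=.
rewrite [P r (P r x)]orth_proj_id ?orth_proj_in// big1 ?addr0 ?subrr// => s sr.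
apply/eqP; rewrite orth_proj_eq0; apply/orthov_dotP => v vE.
by rewrite -(orth_proj_id dot vE) eigen_proj_orthogonal.
Qed.

Lemma moment_spectral rs z m : (forall x, x = \sum_(r <- rs) P r x) ->
  dot z (iter m T z) = \sum_(r <- rs) r ^+ m * dot (P r z) (P r z).
Proof.
move=> dec; have -> : iter m T z = \sum_(r <- rs) r ^+ m *: P r z.
  elim: m => [|m IHm] /=; first by under eq_bigr do rewrite expr0 scale1r.
  rewrite IHm linear_sum/=; apply: eq_bigr => r _.
  by rewrite linearZ/= eigen_proj scalerA -exprSr.
rewrite linear_sumr/=; apply: eq_bigr => r _.
by rewrite dotZr dotC dot_orth_proj.
Qed.

End SpectralTheorem.

(** * Moments of a finite measure on the half-line *)

Lemma has_max_seq (R : realType) (s : seq R) (p : pred R) : has p s ->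
  exists2 x, x \in s /\ p x & forall y, y \in s -> p y -> y <= x.
Proof.
elim: s => //= x s IHs; have [sp _|sNp] := boolP (has p s); last first.
  rewrite orbF => px; exists x; first by rewrite mem_head.
  move=> y; rewrite inE => /orP[/eqP -> //|ys] py.
  by move: sNp => /hasPn/(_ y ys); rewrite py.
have [y [ys py] ymax] := IHs sp.
have [/andP[px yx]|xNy] := boolP (p x && (y <= x)).
  exists x; first by rewrite mem_head.
  move=> z; rewrite inE => /orP[/eqP -> //|zs] pz.
  exact: le_trans (ymax z zs pz) yx.
exists y; first by rewrite inE ys orbT.
move=> z; rewrite inE => /orP[/eqP ->|]; last exact: ymax.
by move=> px; move: xNy; rewrite px/= -ltNge => /ltW.
Qed.

(** For masses [w r] at finitely many points [r >= 0], the [m]-th moment grows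
    like [lam ^+ m], where [lam] is the largest point of positive mass. Points
    without mass are unconstrained: they stand for elements of a list of
    candidate eigenvalues that do not contribute. *)
Section Moments.
Variables (R : realType) (s : seq R) (w : R -> R) (lam : R).
Hypothesis s_ge0 : forall r, r \in s -> 0 < w r -> 0 <= r.
Hypothesis w_ge0 : forall r, 0 <= w r.
Hypotheses (lam_s : lam \in s) (lam_gt0 : 0 < lam) (wlam_gt0 : 0 < w lam).
Hypothesis lam_max : forall r, r \in s -> 0 < w r -> r <= lam.

Let mom m := \sum_(r <- s) r ^+ m * w r.

Let s_le r : r \in s -> w r = 0 \/ 0 <= r <= lam.
Proof.
move=> rs; have [w0|wN0] := eqVneq (w r) 0; first by left.
have wr_gt0 : 0 < w r by rewrite lt_def wN0 w_ge0.
by right; rewrite s_ge0//= lam_max.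
Qed.

Lemma moment_gt0 m : 0 < mom m.
Proof.
rewrite /mom (big_rem lam)//= ltr_pwDl ?mulr_gt0 ?exprn_gt0//.
rewrite big_seq sumr_ge0// => r /mem_rem rs.
have [->|/andP[r0 _]] := s_le rs; first by rewrite mulr0.
exact: mulr_ge0 (exprn_ge0 _ r0) (w_ge0 r).
Qed.

Lemma moment_le m : mom m.+1 <= lam * mom m.
Proof.
rewrite /mom mulr_sumr big_seq [leRHS]big_seq ler_sum// => r rs.
rewrite exprS -mulrA; have [->|/andP[r0 rlam]] := s_le rs.
  by rewrite !mulr0.
by rewrite ler_wpM2r// mulr_ge0 ?exprn_ge0.
Qed.

(** Every point of positive mass below [lam] contributes a geometric sequence of
    ratio less than [1], so only the mass at [lam] survives. *)
Lemma moment_normalized_cvg :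
  (fun m => mom m / lam ^+ m) @ \oo --> \sum_(r <- s) (r == lam)%:R * w r.
Proof.
rewrite (_ : (fun m => _) =
             (fun m => \sum_(r <- s) (r / lam) ^+ m * w r)); last first.
  apply/funext => m; rewrite /mom mulr_suml; apply: eq_bigr => r _.
  by rewrite expr_div_n mulrAC.
have := @s_le; elim: s => [|r t IHt] tle.
  under eq_fun do rewrite big_nil; rewrite big_nil; exact: cvg_cst.
under eq_fun do rewrite big_cons; rewrite big_cons.
apply: cvgD; last by apply: IHt => q qt; apply: tle; rewrite inE qt orbT.
have [->|/andP[r0 rlam]] := tle r (mem_head _ _).
  by rewrite mulr0; under eq_fun do rewrite mulr0; exact: cvg_cst.
have [->|rNlam] := eqVneq r lam.
  under eq_fun do rewrite divff ?gt_eqF// expr1n; exact: cvg_cst.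
apply: cvgMl; apply: cvg_expr.
rewrite ger0_norm ?divr_ge0 ?(ltW lam_gt0)// ltr_pdivrMr// mul1r.
by rewrite lt_neqAle rNlam.
Qed.

Lemma moment_ratio_cvg : (fun m => mom m.+1 / mom m) @ \oo --> lam.
Proof.
have cv := moment_normalized_cvg; set L := \sum_(r <- s) _ in cv.
have L0 : L != 0.
  rewrite gt_eqF// /L (big_rem lam)//= eqxx mul1r ltr_pwDl//.
  by rewrite sumr_ge0// => r _; rewrite mulr_ge0// ler0n.
rewrite (_ : (fun m => _) =
  (fun m => lam * (mom m.+1 / lam ^+ m.+1) * (mom m / lam ^+ m)^-1)).
  rewrite -[X in _ --> X](mulfK L0); apply: cvgM; last exact: cvgV.
  apply: cvgM; first exact: cvg_cst.
  by rewrite -cvg_shiftS in cv.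
apply/funext => m; rewrite exprS; field.
by rewrite !gt_eqF ?moment_gt0 ?exprn_gt0.
Qed.

End Moments.

(** * The rate attached to a positive operator and a vector *)

Section SpectralRate.
Variables (R : realType) (V : vectType R) (dot : {dot V for idfun}).
Variables (T : 'End(V)) (Tsa : self_adjoint dot T).
Hypothesis T_ge0 : forall u, 0 <= dot (T u) u.
Variable x : V.

Local Notation P l := (orth_proj dot (passmx.leigenspace T l)).
Let z := x - P 1 x.

Let eigen_proj_comp l m u : l != m -> P l (P m u) = 0.
Proof.
move=> lm; apply/eqP; rewrite orth_proj_eq0; apply/orthov_dotP => v vE.
by rewrite -(orth_proj_id dot vE) eigen_proj_orthogonal// eq_sym.
Qed.

Let proj_z l : l != 1 -> P l z = P l x.
Proof. by move=> l1; rewrite linearB/= eigen_proj_comp// subr0. Qed.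

Let proj1_z : P 1 z = 0.
Proof. by apply/eqP; rewrite orth_proj_eq0 orth_proj_perp. Qed.

(** Removing from [x] its component fixed by [T] leaves a vector [z] with the
    same components as [x] in the other eigenspaces. The numbers
    [dot z (T^m z)] are the moments of the measure with mass [|P r z|^2] at
    [r], and [lam] is the largest point of positive mass; it is positive
    because the first moment is. *)
Lemma spectral_rate : 0 < dot z (T z) -> exists lam : R,
  [/\ is_max (eigenvalues_at dot x T `\` [set 0; 1]) lam, 0 < lam,
      forall m, 0 < dot z (iter m T z),
      forall m, dot z (iter m.+1 T z) <= lam * dot z (iter m T z) &
      (fun m => dot z (iter m.+1 T z) / dot z (iter m T z)) @ \oo --> lam].
Proof.
have [rs dec] := spectral_decomposition Tsa.
pose w r := dot (P r z) (P r z).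
have w_ge0 r : 0 <= w r by exact: dot_ge0.
have w_gt0 r : (0 < w r) = (P r z != 0) by rewrite dot_gt0.
have mom m : dot z (iter m T z) = \sum_(r <- rs) r ^+ m * w r.
  exact: moment_spectral.
have rs_ge0 r : r \in rs -> 0 < w r -> 0 <= r.
  move=> _ wr; have := T_ge0 (P r z); rewrite eigen_proj dotZl.
  by rewrite pmulr_lge0.
move=> mom1; have : has (fun r => 0 < r * w r) rs.
  apply/negPn/negP => /hasPn neg; move: mom1; rewrite (mom 1) ltNge.
  rewrite big_seq sumr_le0// => r rrs.
  by rewrite expr1 leNgt neg.
move=> /has_max_seq[lam [lam_rs lamw] lam_max].
have wlam : 0 < w lam.
  rewrite lt_def w_ge0 andbT; apply: contraTneq lamw => ->.
  by rewrite mulr0 ltxx.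
have lam_gt0 : 0 < lam by move: lamw; rewrite pmulr_lgt0.
have lam_ub r : r \in rs -> 0 < w r -> r <= lam.
  move=> rrs wr; have [r0|r0] := leP r 0.
    exact: le_trans r0 (ltW lam_gt0).
  by apply: lam_max => //; rewrite mulr_gt0.
exists lam; split=> //.
- have lam1 : lam != 1.
    by apply: contraTneq wlam => ->; rewrite w_gt0 proj1_z eqxx.
  split.
    split; last first.
      move=> [/= lam0|/= lamE]; last by move: lam1; rewrite lamE eqxx.
      by move: lam_gt0; rewrite lam0 ltxx.
    split; last by rewrite -proj_z// -w_gt0.
    rewrite w_gt0 in wlam.
    by apply: leigenvalue_witness wlam; exact: eigen_proj.
  move=> l [[_ lx] /not_orP[/eqP l0 /eqP l1]].
  rewrite -proj_z// in lx.
  apply: lam_ub; last by rewrite w_gt0.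
  apply: contraNT lx => lrs.
  rewrite [z in P l z]dec linear_sum/= big_seq big1// => r rrs.
  by apply: eigen_proj_comp; apply: contraNneq lrs => ->.
- by move=> m; rewrite mom (moment_gt0 rs_ge0 w_ge0 lam_rs lam_gt0).
- by move=> m; rewrite !mom (moment_le rs_ge0 w_ge0).
under eq_fun do rewrite !mom.
exact: (moment_ratio_cvg rs_ge0 w_ge0 lam_rs lam_gt0).
Qed.

End SpectralRate.

(** * The two operators built from a pair of projections *)

Section TwoProjections.
Variables (R : realType) (V : vectType R) (dot : {dot V for idfun}).
Variables (A B : {vspace V}).
Implicit Types (u v x y : V) (l : R) (M : {vspace V}).

Local Notation P := (orth_proj dot).
Local Notation S := (P B \o P A \o P B)%VF.
Local Notation W := (2^-1 *: (P A + P B)).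

Lemma orth_proj_pythagoras M u :
  dot u u = dot (P M u) (P M u) + dot (u - P M u) (u - P M u).
Proof.
have Pu := dot_orth_proj dot M u.
by rewrite dotBl !dotBr (dotC dot u (P M u)) Pu; ring.
Qed.

Lemma orth_proj_contract M u : dot (P M u) (P M u) <= dot u u.
Proof. by rewrite [leRHS](orth_proj_pythagoras M) lerDl dot_ge0. Qed.

(** A projection preserves the norm only of vectors of its range: by Pythagoras
    the component orthogonal to [M] has to vanish. *)
Lemma orth_proj_norm_mem M u : dot u u <= dot (P M u) (P M u) -> u \in M.
Proof.
rewrite [leLHS](orth_proj_pythagoras M) gerDl => le0.
have /eqP : dot (u - P M u) (u - P M u) = 0.
  by apply/le_anti; rewrite le0 dot_ge0.
by rewrite dot_eq0 subr_eq0 => /eqP ->; exact: orth_proj_in.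
Qed.

Lemma sandwichE u : S u = P B (P A (P B u)).
Proof. by rewrite !comp_lfunE. Qed.

Lemma averageE u : W u = 2^-1 *: (P A u + P B u).
Proof. by rewrite scale_lfunE add_lfunE. Qed.

Lemma sandwich_dot u v : dot (S u) v = dot (P A (P B u)) (P A (P B v)).
Proof.
rewrite sandwichE orth_proj_self_adjoint [RHS](dotC dot).
by rewrite [RHS]orth_proj_dotl ?orth_proj_in// (dotC dot).
Qed.

Lemma sandwich_self_adjoint : self_adjoint dot S.
Proof. by move=> u v; rewrite (dotC dot u) !sandwich_dot dotC. Qed.

Lemma sandwich_ge0 u : 0 <= dot (S u) u.
Proof. by rewrite sandwich_dot dot_ge0. Qed.

Lemma average_dot u v : dot (W u) v = 2^-1 * (dot (P A u) v + dot (P B u) v).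
Proof. by rewrite averageE dotZl dotDl. Qed.

Lemma average_self_adjoint : self_adjoint dot W.
Proof.
move=> u v; rewrite (dotC dot u) !average_dot.
rewrite (orth_proj_self_adjoint dot A u) (orth_proj_self_adjoint dot B u).
by rewrite !(dotC dot u).
Qed.

Lemma average_ge0 u : 0 <= dot (W u) u.
Proof. by rewrite average_dot !dot_orth_proj mulr_ge0 ?addr_ge0 ?dot_ge0. Qed.

(** The chain [|u| = |P_A P_B u| <= |P_B u| <= |u|] of equalities forces [u]
    into [B] and then into [A]. *)
Lemma sandwich_fixed : passmx.leigenspace S 1 = (A :&: B)%VS.
Proof.
apply/vspaceP => u; rewrite mem_leigenspace scale1r memv_cap.
apply/eqP/andP => [Su|[uA uB]]; last by rewrite sandwichE !orth_proj_id.
have uE : dot u u = dot (P A (P B u)) (P A (P B u)) by rewrite -sandwich_dot Su.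
have uB : u \in B.
  by apply: orth_proj_norm_mem; rewrite uE orth_proj_contract.
split=> //; apply: orth_proj_norm_mem.
by rewrite {1}uE (orth_proj_id dot uB).
Qed.

(** Here [|u|^2] is the mean of [|P_A u|^2] and [|P_B u|^2], neither of which
    exceeds it, so both are equal to it. *)
Lemma average_fixed : passmx.leigenspace W 1 = (A :&: B)%VS.
Proof.
apply/vspaceP => u; rewrite mem_leigenspace scale1r memv_cap.
apply/eqP/andP => [Wu|[uA uB]]; last first.
  have half2 : 2^-1 + 2^-1 = 1 :> R by lra.
  by rewrite averageE !orth_proj_id// scalerDr -scalerDl half2 scale1r.
have uE : dot u u = 2^-1 * (dot (P A u) (P A u) + dot (P B u) (P B u)).
  by rewrite -{1}Wu average_dot !dot_orth_proj.
have uA := orth_proj_contract A u; have uB := orth_proj_contract B u.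
by split; apply: orth_proj_norm_mem; lra.
Qed.

(** The maximum that defines the Friedrichs angle is taken over the unit balls;
    rescaling turns it into a sharpened Cauchy-Schwarz inequality. *)
Lemma friedrichs_cauchy_schwarz theta u v : is_friedrichs_angle dot A B theta ->
  u \in (A :&: orthov dot (A :&: B))%VS ->
  v \in (B :&: orthov dot (A :&: B))%VS ->
  dot u v <= cos theta * (dot_norm dot u * dot_norm dot v).
Proof.
move=> [_ [_ ub]] uA vB.
have [->|u0] := eqVneq u 0.
  by rewrite dot0l /dot_norm dot0l sqrtr0 mul0r mulr0.
have [->|v0] := eqVneq v 0.
  by rewrite dot0r /dot_norm dot0l sqrtr0 !mulr0.
have nu : 0 < dot_norm dot u by rewrite dot_norm_gt0.
have nv : 0 < dot_norm dot v by rewrite dot_norm_gt0.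
have unit_norm y : y != 0 -> dot_norm dot ((dot_norm dot y)^-1 *: y) <= 1.
  move=> y0; have ny : dot_norm dot y != 0 by rewrite gt_eqF ?dot_norm_gt0.
  rewrite {1}/dot_norm dotZl dotZr -sqr_dot_norm mulrA -expr2 exprVn.
  rewrite mulVf ?sqrtr1//.
  by rewrite expf_neq0.
rewrite -ler_pdivrMr ?mulr_gt0//; apply: ub => /=.
exists ((dot_norm dot u)^-1 *: u), ((dot_norm dot v)^-1 *: v).
split; [exact: memvZ|exact: memvZ|exact: unit_norm|exact: unit_norm|].
by rewrite dotZl dotZr invfM mulrA mulrC.
Qed.

Lemma friedrichs_cos_ge0 theta :
  is_friedrichs_angle dot A B theta -> 0 <= cos theta.
Proof.
move=> [_ [_ ub]]; apply: ub; exists 0, 0.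
by split; rewrite ?mem0v ?dot0l// /dot_norm dot0l sqrtr0.
Qed.

(** Both operators fix exactly the vectors of [A :&: B], so their other
    eigenvectors are orthogonal to [A :&: B], which is what brings the
    Friedrichs angle into play. *)
Lemma eigenvector_perp T M l y : self_adjoint dot T ->
  passmx.leigenspace T 1 = M -> l != 1 -> T y = l *: y -> y \in orthov dot M.
Proof.
move=> Tsa <- l1 Ty; apply/orthov_dotP => v; rewrite mem_leigenspace => /eqP Tv.
exact: (eigenspaces_orthogonal Tsa l1 Ty Tv).
Qed.

Lemma orth_proj_perp_cap M N y : (N <= M)%VS -> y \in orthov dot N ->
  P M y \in (M :&: orthov dot N)%VS.
Proof.
move=> NM /orthov_dotP yN; rewrite memv_cap orth_proj_in.
apply/orthov_dotP => v vN.
by rewrite orth_proj_dotl ?yN// (subvP NM).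
Qed.

(** Since [l != 0], the eigenvector [y] lies in [B]. With [u = P_A y] one has
    [<u, y> = |u|^2 = l |y|^2], and the Friedrichs inequality for [u] and [y]
    reads [l <= cos theta * sqrt l]. *)
Lemma sandwich_eigenvalue_le theta l y : is_friedrichs_angle dot A B theta ->
  y != 0 -> S y = l *: y -> 0 < l -> l != 1 -> l <= cos theta ^+ 2.
Proof.
move=> thP y0 Sy l0 l1.
have yN := eigenvector_perp sandwich_self_adjoint sandwich_fixed l1 Sy.
have yB : y \in B.
  have -> : y = l^-1 *: S y by rewrite Sy scalerA mulVf ?scale1r// gt_eqF.
  by rewrite memvZ// sandwichE orth_proj_in.
have PyB := orth_proj_id dot yB.
have uu : dot (P A y) (P A y) = l * dot y y.
  by rewrite -dotZl -Sy sandwich_dot PyB.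
have := friedrichs_cauchy_schwarz thP (orth_proj_perp_cap (capvSl A B) yN).
move=> /(_ y); rewrite memv_cap yB yN => /(_ isT).
have ny : 0 < dot_norm dot y by rewrite dot_norm_gt0.
rewrite dot_orth_proj uu -sqr_dot_norm.
have -> : dot_norm dot (P A y) = Num.sqrt l * dot_norm dot y.
  by rewrite {1}/dot_norm uu sqrtrM ?(ltW l0).
rewrite -{1}[l]sqr_sqrtr ?(ltW l0)//.
have sl : 0 < Num.sqrt l by rewrite sqrtr_gt0.
have -> : Num.sqrt l ^+ 2 * dot_norm dot y ^+ 2 =
  Num.sqrt l * (Num.sqrt l * dot_norm dot y ^+ 2) by ring.
have -> : cos theta * (Num.sqrt l * dot_norm dot y * dot_norm dot y) =
  cos theta * (Num.sqrt l * dot_norm dot y ^+ 2) by ring.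
rewrite ler_pM2r ?mulr_gt0 ?exprn_gt0// => slc.
rewrite -[l]sqr_sqrtr ?(ltW l0)// lerXn2r ?nnegrE ?sqrtr_ge0//.
exact: friedrichs_cos_ge0 thP.
Qed.

(** Put [u = P_A y] and [v = P_B y], so that [u + v = 2 l y]. Pairing with [u]
    and with [v] gives [<u, v> = (2 l - 1) |u|^2 = (2 l - 1) |v|^2], and the
    Friedrichs inequality for the pairs [(u, v)] and [(- u, v)] bounds
    [|2 l - 1|] by [cos theta]. *)
Lemma average_eigenvalue_bounds theta l y : is_friedrichs_angle dot A B theta ->
  y != 0 -> W y = l *: y -> l != 0 -> l != 1 ->
  2^-1 - 2^-1 * cos theta <= l <= 2^-1 + 2^-1 * cos theta.
Proof.
move=> thP y0 Wy l0 l1.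
have c0 := friedrichs_cos_ge0 thP.
have yN := eigenvector_perp average_self_adjoint average_fixed l1 Wy.
have uN := orth_proj_perp_cap (capvSl A B) yN.
have vN := orth_proj_perp_cap (capvSr A B) yN.
set u := P A y in uN *; set v := P B y in vN *.
have sumE : u + v = (2 * l) *: y.
  by rewrite -scalerA -Wy averageE scalerA mulfV ?scale1r.
have uv : dot u v = (2 * l - 1) * dot u u.
  have := congr1 (dot u) sumE.
  rewrite dotZr dot_orth_proj -/u (dotC dot u (u + v)) dotDl (dotC dot v u).
  by move=> h; rewrite mulrBl -h; ring.
have vu : dot u v = (2 * l - 1) * dot v v.
  have := congr1 (dot v) sumE.
  rewrite dotZr dot_orth_proj -/v (dotC dot v (u + v)) dotDl.
  by move=> h; rewrite mulrBl -h; ring.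
have [k0|k0] := eqVneq (2 * l - 1) 0; first by apply/andP; split; lra.
have uuvv : dot u u = dot v v by apply: (mulfI k0); rewrite -uv -vu.
have uu : 0 < dot u u.
  rewrite dot_gt0; apply: contraNneq y0 => u0.
  have v0 : v = 0 by apply/eqP; rewrite -(dot_eq0 dot) -uuvv u0 dot0l.
  have /eqP : (2 * l) *: y = 0 by rewrite -sumE u0 v0 addr0.
  by rewrite scaler_eq0 mulf_eq0 (negbTE l0) pnatr_eq0.
have nn : dot_norm dot u * dot_norm dot v = dot u u.
  by rewrite -sqr_dot_norm expr2 /dot_norm uuvv.
have le1 := friedrichs_cauchy_schwarz thP uN vN.
have uN' : - u \in (A :&: orthov dot (A :&: B))%VS by rewrite memvN.
have := friedrichs_cauchy_schwarz thP uN' vN.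
have -> : dot_norm dot (- u) = dot_norm dot u.
  by rewrite /dot_norm -scaleN1r dotZl dotZr mulN1r mulN1r opprK.
rewrite -scaleN1r dotZl mulN1r nn uv -mulNr ler_pM2r// => le2.
rewrite nn uv ler_pM2r// in le1.
by apply/andP; split; lra.
Qed.

End TwoProjections.

(** * Rates of convergence *)

(** For squared errors that are moments of order [phi k], when one step of the
    iteration raises the order by two: the quotient of two successive squared
    errors tends to [lam ^+ 2]. *)
Lemma root_ratio2_cvg (R : realType) (mom : nat -> R) (lam : R)
    (phi : nat -> nat) :
  0 < lam -> (forall m, 0 < mom m) ->
  (fun m => mom m.+1 / mom m) @ \oo --> lam -> (forall k, k <= phi k)%N ->
  (fun k => Num.sqrt (mom (phi k).+2) / Num.sqrt (mom (phi k))) @ \oo --> lam.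
Proof.
move=> lam0 mom0 cv phik.
have cvq : (fun m => mom m.+2 / mom m) @ \oo --> lam * lam.
  rewrite (_ : (fun m => _) =
    (fun m => (mom m.+2 / mom m.+1) * (mom m.+1 / mom m))).
    by apply: cvgM => //; rewrite -cvg_shiftS in cv.
  by apply/funext => m; rewrite mulrA divfK// gt_eqF.
have cv2 : (fun m => Num.sqrt (mom m.+2 / mom m)) @ \oo --> lam.
  rewrite -[X in _ --> X](ger0_norm (ltW lam0)) -sqrtr_sqr expr2.
  exact: cvg_comp cvq (@sqrt_continuous R _).
rewrite (_ : (fun k => _) = (fun m => Num.sqrt (mom m.+2 / mom m)) \o phi).
  apply: cvg_comp cv2; apply/cvgnyPge => N.
  by exists N => // k /= Nk; exact: leq_trans Nk (phik k).
by apply/funext => k /=; rewrite sqrtrM ?(ltW (mom0 _))// sqrtrV// ltW.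
Qed.

Section Rates.
Variables (R : realType) (V : vectType R) (dot : {dot V for idfun}).
Variables (A B : {vspace V}) (theta : R).
Hypothesis thetaP : is_friedrichs_angle dot A B theta.
Variable x : V.

Local Notation P := (orth_proj dot).
Local Notation S := (P B \o P A \o P B)%VF.
Local Notation W := (2^-1 *: (P A + P B)).
Local Notation z := (x - P (A :&: B)%VS x).

Lemma iter_sub_fixed (T : 'End(V)) (u v : V) k : T v = v ->
  iter k T u - v = iter k T (u - v).
Proof. by move=> Tv; elim: k => //= k <-; rewrite linearB/= Tv. Qed.

Lemma iter_dot (T : 'End(V)) i j u v : self_adjoint dot T ->
  dot (iter i T u) (iter j T v) = dot u (iter (i + j) T v).
Proof.
by move=> Tsa; elim: i j => //= i IHi j; rewrite Tsa -iterS IHi addnS.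
Qed.

(** As [P_B] is idempotent, [(P_A P_B)^(k+1) = P_A P_B (P_B P_A P_B)^k]: up to
    the outer factor [P_A P_B], the iteration is governed by the self-adjoint
    operator [P_B P_A P_B]. *)
Lemma iter_alternating k u :
  iter k.+1 (P A \o P B)%VF u = P A (P B (iter k S u)).
Proof.
elim: k => [|k IHk]; first by rewrite /= comp_lfunE.
rewrite iterS IHk [iter k.+1 _ _]iterS sandwichE comp_lfunE.
by rewrite (orth_proj_id dot (orth_proj_in dot B (P A _))).
Qed.

Let Q_in : P (A :&: B)%VS x \in (A :&: B)%VS. Proof. exact: orth_proj_in. Qed.
Let QA : P A (P (A :&: B)%VS x) = P (A :&: B)%VS x.
Proof. by move: Q_in; rewrite memv_cap => /andP[? _]; rewrite orth_proj_id. Qed.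
Let QB : P B (P (A :&: B)%VS x) = P (A :&: B)%VS x.
Proof. by move: Q_in; rewrite memv_cap => /andP[_ ?]; rewrite orth_proj_id. Qed.

(** The squared error is a moment of odd order because the outer factor
    [P_A P_B] contributes one copy of [P_B P_A P_B]. At [k = 0] the truncated
    predecessor gives order [0], and this missing step from [0] to [1] instead
    of from [-1] is what turns the first rate into [sqrt lambda]. *)
Lemma alternating_error k :
  dot_norm dot (iter k (P A \o P B)%VF x - P (A :&: B)%VS x) =
  Num.sqrt (dot z (iter (k.*2.-1) S z)).
Proof.
rewrite iter_sub_fixed ?comp_lfunE ?QB ?QA// /dot_norm; congr Num.sqrt.
case: k => [//|k]; rewrite iter_alternating -sandwich_dot -iterS.
by rewrite (iter_dot _ _ _ _ (sandwich_self_adjoint dot A B)) addSn addnn.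
Qed.

Lemma average_error k :
  dot_norm dot (iter k W x - P (A :&: B)%VS x) =
  Num.sqrt (dot z (iter k.*2 W z)).
Proof.
rewrite iter_sub_fixed; last first.
  have half2 : 2^-1 + 2^-1 = 1 :> R by lra.
  by rewrite averageE QA QB scalerDr -scalerDl half2 scale1r.
by rewrite /dot_norm (iter_dot _ _ _ _ (average_self_adjoint dot A B)) addnn.
Qed.

Lemma alternating_projections_rate :
  let e k := dot_norm dot (iter k (P A \o P B)%VF x - P (A :&: B)%VS x) in
  0 < e 1%N -> exists lam : R,
  [/\ forall k, 0 < e k,
      (fun k => e k.+1 / e k) @ \oo --> lam,
      is_max (eigenvalues_at dot x S `\` [set 0; 1]) lam,
      forall k, e k.+1 <= (if k == 0%N then Num.sqrt lam else lam) * e k &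
      0 < lam <= cos theta ^+ 2].
Proof.
move=> e; have eE k : e k = Num.sqrt (dot z (iter k.*2.-1 S z)).
  exact: alternating_error.
rewrite eE sqrtr_gt0/= => mom1.
have := spectral_rate (sandwich_self_adjoint dot A B)
  (@sandwich_ge0 _ _ dot A B) (x := x).
rewrite sandwich_fixed => /(_ mom1)[lam [lamP lam0 mom0 mom_le cv]].
exists lam; split=> //.
- by move=> k; rewrite eE sqrtr_gt0.
(* The orders are k.*2.-1 without truncation only from k = 1 on. *)
- suff: (fun k => e k.+2 / e k.+1) @ \oo --> lam.
    by rewrite -[in X in _ -> X]cvg_shiftS.
  under eq_fun do rewrite !eE doubleS.
  apply: (@root_ratio2_cvg _ (fun m => dot z (iter m S z)) _
            (fun k => k.*2.+1)) => //.
  by move=> k; rewrite ltnW// ltnS -addnn leq_addr.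
- case=> [|k]; rewrite !eE.
    by rewrite -sqrtrM ?(ltW lam0)// ler_wsqrtr//; exact: (mom_le 0%N).
  rewrite -{2}[lam](ger0_norm (ltW lam0)) -sqrtr_sqr -sqrtrM ?sqr_ge0//.
  rewrite ler_wsqrtr// expr2 -mulrA; apply: le_trans (mom_le k.*2.+2) _.
  by rewrite ler_pM2l//; exact: mom_le.
rewrite lam0; case: lamP => [[[lamE _] lam01] _].
have lam1 : lam != 1 by apply: contra_not_neq lam01 => ->; right.
have [y] : exists2 y, y \in passmx.leigenspace S lam & y != 0.
  by exists (vpick (passmx.leigenspace S lam)); rewrite ?memv_pick// vpick0.
rewrite mem_leigenspace => /eqP Sy y0.
exact: sandwich_eigenvalue_le thetaP y0 Sy lam0 lam1.
Qed.

(** The hypothesis that [P_B z] is nonzero makes the first moment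
    [(|P_A z|^2 + |P_B z|^2) / 2] positive. *)
Lemma average_projections_rate :
  let e k := dot_norm dot (iter k W x - P (A :&: B)%VS x) in
  P B z != 0 -> exists mu : R,
  [/\ forall k, 0 < e k,
      (fun k => e k.+1 / e k) @ \oo --> mu,
      is_max (eigenvalues_at dot x W `\` [set 0; 1]) mu,
      forall k, e k.+1 <= mu * e k &
      2^-1 - 2^-1 * cos theta <= mu <= 2^-1 + 2^-1 * cos theta].
Proof.
move=> e PBz.
have eE k : e k = Num.sqrt (dot z (iter k.*2 W z)) by exact: average_error.
have mom1 : 0 < dot z (W z).
  rewrite dotC average_dot !dot_orth_proj mulr_gt0 ?invr_gt0//.
  by rewrite ltr_wpDl ?dot_ge0// dot_gt0.
have := spectral_rate (average_self_adjoint dot A B)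
  (@average_ge0 _ _ dot A B) (x := x).
rewrite average_fixed => /(_ mom1)[mu [muP mu0 mom0 mom_le cv]].
exists mu; split=> //.
- by move=> k; rewrite eE sqrtr_gt0.
- under eq_fun do rewrite !eE doubleS.
  apply: (@root_ratio2_cvg _ (fun m => dot z (iter m W z)) _
            (fun k => k.*2)) => //.
  by move=> k; rewrite -addnn leq_addr.
- move=> k; rewrite !eE.
  rewrite -{1}[mu](ger0_norm (ltW mu0)) -sqrtr_sqr -sqrtrM ?sqr_ge0//.
  rewrite ler_wsqrtr// expr2 -mulrA; apply: le_trans (mom_le k.*2.+1) _.
  by rewrite ler_pM2l//; exact: mom_le.
case: muP => [[[muE _] mu01] _].
have mu1 : mu != 1 by apply: contra_not_neq mu01 => ->; right.
have [y] : exists2 y, y \in passmx.leigenspace W mu & y != 0.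
  by exists (vpick (passmx.leigenspace W mu)); rewrite ?memv_pick// vpick0.
rewrite mem_leigenspace => /eqP Wy y0.
exact: average_eigenvalue_bounds thetaP y0 Wy (lt0r_neq0 mu0) mu1.
Qed.

End Rates.

(** The alternating iteration can only leave a nonzero error after one step if
    [P_B z] is nonzero, [z] being the initial error; hence the same hypothesis
    starts both iterations. *)
Lemma projections_rates (R : realType) (V : vectType R)
  (dot : {dot V for idfun}) (A B : {vspace V})
  (theta : R) (thetaP : is_friedrichs_angle dot A B theta) (x : V) :
  let P := orth_proj dot in
  let a k := iter k (P A \o P B)%VF x in
  let m k := iter k (2^-1 *: (P A + P B)) x in
  let ea k := dot_norm dot (a k - P (A :&: B)%VS x) in
  let em k := dot_norm dot (m k - P (A :&: B)%VS x) in
  0 < ea 1%N ->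
  (forall k : nat, (1 <= k)%N -> 0 < ea k /\ 0 < em k) /\
  exists lambda mu : R,
    [/\ (fun k => ea k.+1 / ea k) @ \oo --> lambda,
        is_max (eigenvalues_at dot x (P B \o P A \o P B)%VF `\` [set 0; 1])
               lambda,
        (fun k => em k.+1 / em k) @ \oo --> mu &
        is_max (eigenvalues_at dot x (2^-1 *: (P A + P B)) `\` [set 0; 1])
               mu] /\
    [/\ forall k : nat,
          ea k.+1 <= (if k == 0%N then Num.sqrt lambda else lambda) * ea k,
        forall k : nat, em k.+1 <= mu * em k,
        0 < lambda <= cos theta ^+ 2 &
        2^-1 - 2^-1 * cos theta <= mu <= 2^-1 + 2^-1 * cos theta].
Proof.
move=> P a m ea em ea1.
have PBz : P B (x - P (A :&: B)%VS x) != 0.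
  move: ea1; rewrite /ea alternating_error sqrtr_gt0/= dotC sandwich_dot.
  rewrite dot_gt0.
  by apply: contra_neq => ->; rewrite linear0.
have [lam [ea_gt0 ea_cvg lamP ea_le lam_bnd]] :=
  alternating_projections_rate thetaP ea1.
have [mu [em_gt0 em_cvg muP em_le mu_bnd]] :=
  average_projections_rate thetaP PBz.
by split=> [k _|]; [split; [exact: ea_gt0|exact: em_gt0]|exists lam, mu].
Qed.

Theorem theorem4p1 (R : realType) (d : nat) (dot : {dot 'rV[R]_d for idfun})
  (A B : {vspace 'rV[R]_d})
  (A_neq0 : A <> 0%VS) (A_neqT : A <> fullv)
  (B_neq0 : B <> 0%VS) (B_neqT : B <> fullv)
  (thetaF : R) (thetaFP : is_friedrichs_angle dot A B thetaF)
  (a0 x0 : 'rV[R]_d) (a0x0 : a0 = x0) :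
  let P := orth_proj dot in
  let a k := iter k (P A \o P B)%VF a0 in
  let x k := iter k (2^-1 *: (P A + P B)) x0 in
  let ea k := dot_norm dot (a k - P (A :&: B)%VS a0) in
  let ex k := dot_norm dot (x k - P (A :&: B)%VS x0) in
  0 < ea 1%N ->
  (forall k : nat, (1 <= k)%N -> 0 < ea k /\ 0 < ex k) /\
  exists lambda mu : R,
    [/\ (fun k => ea k.+1 / ea k) @ \oo --> lambda,
        is_max (eigenvalues_at dot a0 (P B \o P A \o P B)%VF `\` [set 0; 1])
               lambda,
        (fun k => ex k.+1 / ex k) @ \oo --> mu &
        is_max (eigenvalues_at dot x0 (2^-1 *: (P A + P B)) `\` [set 0; 1])
               mu] /\
    [/\ forall k : nat,
          ea k.+1 <= (if k == 0%N then Num.sqrt lambda else lambda) * ea k,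
        forall k : nat, ex k.+1 <= mu * ex k,
        0 < lambda <= cos thetaF ^+ 2 &
        2^-1 - 2^-1 * cos thetaF <= mu <= 2^-1 + 2^-1 * cos thetaF].
Proof.
rewrite -a0x0.
exact: (@projections_rates R 'rV[R]_d dot A B thetaF thetaFP a0).
Qed.
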